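(* Every finitely generated bicommutative superalgebra over a field of characteristic different from $2$ is weakly noetherian, i.e. it satisfies the ascending chain condition for two-sided ideals.
   Context: Algebras are not assumed associative or unital. A superalgebra is an algebra $A=A_0\oplus A_1$ with $A_iA_j\subseteq A_{i+j\,(\mathrm{mod}\,2)}$; for $a\in A_i$ write $\overline a=i$. A superalgebra is bicommutative if for all homogeneous elements $x_1(x_2x_3)=(-1)^{\overline{x_1}\,\overline{x_2}}x_2(x_1x_3)$ and $(x_1x_2)x_3=(-1)^{\overline{x_2}\,\overline{x_3}}(x_1x_3)x_2$. Finitely generated means generated as an algebra by finitely many homogeneous (even or odd) elements. *)

(* Defs.v *)
From mathcomp Require Import all_boot all_order all_algebra.
From mathcomp Require Import boolp classical_sets.

Set Implicit Arguments.
Unset Strict Implicit.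
Unset Printing Implicit Defensive.

Import GRing.Theory.
Local Open Scope classical_set_scope.
Local Open Scope ring_scope.

(* A (not necessarily associative or unital) algebra over F is an F-vector
   space A with an arbitrary bilinear product mul; MathComp's
   lalgType and algType are not usable here, being associative and unital. *)

Section Algebra.
Context (F : fieldType) (A : lmodType F) (mul : {bilinear A -> A -> A}).

Definition subspace (V : set A) : Prop := GRing.submod_closed (mem V).

Definition subalgebra (B : set A) : Prop :=
  subspace B /\ forall x y, B x -> B y -> B (mul x y).

(* Ideals are arbitrary two-sided ideals, not only the graded ones. *)
Definition two_sided_ideal (I : set A) : Prop :=
  subspace I /\ forall a x, I x -> I (mul a x) /\ I (mul x a).

Definition weakly_noetherian : Prop :=
  forall I : nat -> set A,
    (forall n, two_sided_ideal (I n)) ->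
    (forall n, I n `<=` I n.+1) ->
    exists N, forall n, (N <= n)%N -> I n = I N.

(* Parities are booleans: gr false and gr true are the even and odd parts,
   addb is addition modulo 2 and andb is the product of parities. *)
Variable gr : bool -> set A.

Definition superalgebra : Prop :=
  [/\ forall i, subspace (gr i),
      forall a, exists a0 a1, [/\ gr false a0, gr true a1 & a = a0 + a1],
      gr false `&` gr true = [set 0] &
      forall i j x y, gr i x -> gr j y -> gr (i (+) j) (mul x y)].

Definition homogeneous (x : A) : Prop := exists i, gr i x.

Definition bicommutative : Prop :=
  (forall i1 i2 i3 x1 x2 x3, gr i1 x1 -> gr i2 x2 -> gr i3 x3 ->
     mul x1 (mul x2 x3) = (-1) ^+ (i1 && i2) *: mul x2 (mul x1 x3)) /\
  (forall i1 i2 i3 x1 x2 x3, gr i1 x1 -> gr i2 x2 -> gr i3 x3 ->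
     mul (mul x1 x2) x3 = (-1) ^+ (i2 && i3) *: mul (mul x1 x3) x2).

Definition finitely_generated : Prop :=
  exists s : seq A,
    (forall x, x \in s -> homogeneous x) /\
    smallest subalgebra [set` s] = setT.

End Algebra.

(* Main.v *)
Require Import Defs.
From mathcomp Require Import all_boot all_order all_algebra.
From mathcomp Require Import boolp classical_sets.
Local Open Scope ring_scope.

Import GRing.Theory.
Local Open Scope classical_set_scope.

(** Write [L_a] and [R_a] for left and right multiplication by [a]. The two
    identities say that, for homogeneous elements, left multiplications commute
    with each other up to sign, and so do right multiplications. The link
    between the two kinds is the fact that every product [uv] lies in the middle
    nucleus, [x((uv)y) = (x(uv))y], so that [L_x] and [R_y] commute exactly on
    [A^2] (lemma [product_in_nucleus]). Moreover [(uv)w = +- (uw)v] and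
    [w(uv) = +- u(wv)] express multiplication by a product through
    multiplications by its factors. Hence, if [A] is generated by finitely many
    homogeneous elements [g], then [A^2] is obtained from the finitely many
    products [gh] by the finitely many operators [L_g], [R_g], which commute up
    to sign on [A^2].

    Such an [A^2] satisfies the ascending chain condition for subspaces
    invariant under these operators, by the argument of Hilbert's basis theorem
    ([skew_hilbert_basis]). Operators are adjoined one at a time: if [W]
    satisfies the condition, then for [U] inside the sum of all [t^n W] one
    compares the spaces of leading coefficients of degree [n], namely
    [{w in W | t^n w in U + sum_(i < n) t^i W}]. They increase with [n] and
    with [U], they are invariant because commutation up to a nonzero scalar
    carries invariance through powers of [t], and two nested [U] with the same
    leading coefficients are equal. Everything takes place inside [A^2] itself,
    where the sum of the [t^n W] may fail to be direct.

    Finally [A] is [A^2] plus the span of the generators, and adding finitely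
    many vectors preserves the chain condition ([acc_add_span]). A two-sided
    ideal, graded or not, is invariant under all [L_g] and [R_g]. The grading
    of [A^2] itself is used once: the sign in [(uv)w = +- (uw)v] depends on the
    parity of [w], so the inclusions [aA^2 <= A^2] and [A^2 a <= A^2], known at
    first for generators [a], propagate to products of homogeneous elements by
    splitting [w] into its even and odd parts ([square_ideal]). *)

(** * Subspaces *)

Section Subspaces.
Set Implicit Arguments.
Unset Strict Implicit.
Context (F : fieldType) (A : lmodType F).
Implicit Types (U V W : set A) (t : {linear A -> A}) (x y v : A).

Lemma subspaceP V :
  subspace V <-> V 0 /\ forall (c : F) x y, V x -> V y -> V (c *: x + y).
Proof.
split=> -[h0 hl].
  split; first by move: (h0 : 0 \in V); rewrite in_setE.
  move=> c x y hx hy.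
  have hx' : x \in mem V by rewrite -in_setE in hx.
  have hy' : y \in mem V by rewrite -in_setE in hy.
  by move: (hl c x y hx' hy' : _ \in V); rewrite in_setE.
split; first by have : 0 \in V by rewrite in_setE.
move=> c x y hx hy.
have : c *: x + y \in V; last by [].
rewrite in_setE; apply: hl.
  by move: (hx : x \in V); rewrite in_setE.
by move: (hy : y \in V); rewrite in_setE.
Qed.

Lemma subspace_0 V : subspace V -> V 0.
Proof. by case/subspaceP. Qed.

Lemma subspaceZ V (c : F) x : subspace V -> V x -> V (c *: x).
Proof. by case/subspaceP=> h0 hl hx; rewrite -[c *: x]addr0; apply: hl. Qed.

Lemma subspaceD V x y : subspace V -> V x -> V y -> V (x + y).
Proof. by case/subspaceP=> h0 hl hx hy; rewrite -[x]scale1r; apply: hl. Qed.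

Lemma subspaceB V x y : subspace V -> V x -> V y -> V (x - y).
Proof.
by move=> sV hx hy; apply: subspaceD => //; rewrite -scaleN1r; apply: subspaceZ.
Qed.

Lemma subspace_zero : subspace [set 0 : A].
Proof.
by apply/subspaceP; split=> // c x y /= -> ->; rewrite scaler0 addr0.
Qed.

Lemma subspaceI U V : subspace U -> subspace V -> subspace (U `&` V).
Proof.
move=> /subspaceP[u0 uL] /subspaceP[v0 vL]; apply/subspaceP; split=> //.
by move=> c x y [ux vx] [uy vy]; split; [apply: uL | apply: vL].
Qed.

Definition sumsp U V : set A := [set x | exists u v, [/\ U u, V v & x = u + v]].

Lemma subspace_sum U V : subspace U -> subspace V -> subspace (sumsp U V).
Proof.
move=> /subspaceP[u0 uL] /subspaceP[v0 vL]; apply/subspaceP; split.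
  by exists 0, 0; split=> //; rewrite addr0.
move=> c _ _ [u [v [hu hv ->]]] [u' [v' [hu' hv' ->]]].
exists (c *: u + u'), (c *: v + v'); split; [exact: uL | exact: vL |].
by rewrite scalerDr addrACA.
Qed.

Lemma sub_sumspl U V : subspace V -> U `<=` sumsp U V.
Proof. by move=> /subspace_0 v0 x hx; exists x, 0; rewrite addr0. Qed.

Lemma sub_sumspr U V : subspace U -> V `<=` sumsp U V.
Proof. by move=> /subspace_0 u0 x hx; exists 0, x; rewrite add0r. Qed.

Lemma sumspS U U' V V' :
  U `<=` U' -> V `<=` V' -> sumsp U V `<=` sumsp U' V'.
Proof. by move=> hU hV _ [u [v [/hU hu /hV hv ->]]]; exists u, v. Qed.

Lemma sumsp_sub U V W : subspace W -> U `<=` W -> V `<=` W -> sumsp U V `<=` W.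
Proof. by move=> sW hU hV _ [u [v [/hU hu /hV hv ->]]]; apply: subspaceD. Qed.

Definition line v : set A := range (fun c : F => c *: v).

Lemma subspace_line v : subspace (line v).
Proof.
apply/subspaceP; split; first by exists 0 => //; rewrite scale0r.
move=> c _ _ [a _ <-] [b _ <-]; exists (c * a + b) => //.
by rewrite scalerDl scalerA.
Qed.

Lemma line_sub v W : subspace W -> W v -> line v `<=` W.
Proof. by move=> sW hv _ [c _ <-]; apply: subspaceZ. Qed.

Lemma line_id v : line v v.
Proof. by exists 1 => //; rewrite scale1r. Qed.

Definition add_span W (vs : seq A) := foldr (fun v => sumsp (line v)) W vs.

Lemma subspace_add_span W vs : subspace W -> subspace (add_span W vs).
Proof.
move=> sW; elim: vs => //= v vs IH.
by apply: subspace_sum => //; apply: subspace_line.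
Qed.

Lemma sub_add_span W vs : W `<=` add_span W vs.
Proof.
elim: vs => //= v vs IH; apply: subset_trans IH _.
by apply: sub_sumspr; apply: subspace_line.
Qed.

Lemma mem_add_span W vs v : subspace W -> v \in vs -> add_span W vs v.
Proof.
move=> sW; elim: vs => //= u vs IH; rewrite inE => /orP[/eqP->|/IH hv].
  by apply: sub_sumspl; [apply: subspace_add_span | apply: line_id].
by apply: sub_sumspr; [apply: subspace_line |].
Qed.

Lemma add_span_sub W vs V :
  subspace V -> W `<=` V -> (forall v, v \in vs -> V v) -> add_span W vs `<=` V.
Proof.
move=> sV hW; elim: vs => //= v vs IH hvs; apply: sumsp_sub => //.
  by apply: line_sub => //; apply: hvs; rewrite mem_head.
by apply: IH => u hu; apply: hvs; rewrite inE hu orbT.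
Qed.

Definition stable (f : A -> A) V := V `<=` f @^-1` V.

Lemma subspace_preim t V : subspace V -> subspace (t @^-1` V).
Proof.
move=> /subspaceP[v0 vL]; apply/subspaceP; split; first by rewrite /= linear0.
by move=> c x y hx hy; rewrite /= linearP; apply: vL.
Qed.

Lemma linear_iter t n (c : F) x y :
  iter n t (c *: x + y) = c *: iter n t x + iter n t y.
Proof. by elim: n => //= n ->; rewrite linearP. Qed.

Lemma iter0 t n : iter n t 0 = 0.
Proof. by elim: n => //= n ->; rewrite linear0. Qed.

Lemma subspace_iter_image t n W : subspace W -> subspace (iter n t @` W).
Proof.
move=> /subspaceP[w0 wL]; apply/subspaceP; split.
  by exists 0 => //; rewrite iter0.
move=> c _ _ [x hx <-] [y hy <-]; exists (c *: x + y); first exact: wL.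
by rewrite linear_iter.
Qed.

Lemma subspace_iter_preim t n W : subspace W -> subspace (iter n t @^-1` W).
Proof.
move=> /subspaceP[w0 wL]; apply/subspaceP; split; first by rewrite /= iter0.
by move=> c x y hx hy; rewrite /= linear_iter; apply: wL.
Qed.

End Subspaces.

(** * The ascending chain condition for invariant subspaces *)

Section InvariantChains.
Set Implicit Arguments.
Unset Strict Implicit.
Context (F : fieldType) (A : lmodType F).
Context (J : eqType) (T : J -> {linear A -> A}).
Implicit Types (s : seq J) (W M : set A).

Definition invariant s W := forall j, j \in s -> stable (T j) W.

Definition acc s W := forall U : nat -> set A,
  (forall n, subspace (U n)) -> (forall n, invariant s (U n)) ->
  (forall n, U n `<=` W) -> (forall n, U n `<=` U n.+1) ->
  exists N, forall n, (N <= n)%N -> U n `<=` U N.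

Lemma chain_le (U : nat -> set A) : (forall n, U n `<=` U n.+1) ->
  forall m n, (m <= n)%N -> U m `<=` U n.
Proof.
move=> hU; apply: homo_leq hU => [V | V U' W]; first exact: subset_refl.
exact: subset_trans.
Qed.

Lemma acc_zero s : acc s [set 0].
Proof.
move=> U sU _ U0 _; exists 0%N => n _ x /U0 /= ->; exact: subspace_0.
Qed.

Lemma invariant_add_span s W vs : subspace W -> invariant s W ->
  (forall v j, v \in vs -> j \in s -> W (T j v)) ->
  invariant s (add_span W vs).
Proof.
move=> sW iW hvs j js x hx; apply: sub_add_span; move: x hx.
apply: add_span_sub; [exact: subspace_preim | exact: iW |].
by move=> v hv; apply: hvs.
Qed.

(** A chain [U n] inside [line v + W] is controlled by the chain of the
    [U n `&` W] and by whether [U n] contains some vector of the coset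
    [v + W]. *)
Lemma acc_add_line s W v : subspace W -> invariant s W -> acc s W ->
  acc s (sumsp (line v) W).
Proof.
move=> sW iW aW U sU iU UW mU; have leU := chain_le mU.
have [N1 hN1] : exists N, forall n, (N <= n)%N -> U n `&` W `<=` U N `&` W.
  apply: (aW (fun n => U n `&` W)) => n.
  - exact: subspaceI.
  - by move=> j js x [/(iU n j js) ux /(iW j js) wx].
  - exact: subIsetr.
  - by move=> x [/mU ux wx].
(* Once [U n] meets the coset, so do all later members: one index decides. *)
pose meets_coset n := exists w, W w /\ U n (v + w).
have [N2 hN2] : exists N, forall n, meets_coset n -> meets_coset N.
  have [[n sn]|nos] := pselect (exists n, meets_coset n); first by exists n.
  by exists 0%N => n sn; case: nos; exists n.
exists (maxn N1 N2) => n; rewrite geq_max => /andP[le1 le2] x ux.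
have [_ [w [[c _ <-] hw ex]]] := UW n x ux.
have UN1 y : U n y -> W y -> U (maxn N1 N2) y.
  by move=> uy wy; apply: (leU N1); [rewrite leq_maxl | case: (hN1 n le1 y)].
have [c0|c0] := eqVneq c 0.
  by apply: UN1 => //; rewrite ex c0 scale0r add0r.
have [w' [hw' uw']] : meets_coset N2.
  apply: (hN2 n); exists (c^-1 *: w); split; first exact: subspaceZ.
  have -> : v + c^-1 *: w = c^-1 *: x.
    by rewrite ex scalerDr scalerA mulVf // scale1r.
  exact: subspaceZ.
have -> : x = (x - c *: (v + w')) + c *: (v + w') by rewrite subrK.
have uN : U (maxn N1 N2) (v + w') by apply: (leU N2) => //; rewrite leq_maxr.
apply: subspaceD => //; last exact: subspaceZ.
apply: UN1.
  apply: subspaceB => //; apply: subspaceZ => //; exact: leU uw'.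
have -> : x - c *: (v + w') = w - c *: w'.
  by rewrite ex scalerDr opprD addrACA subrr add0r.
by apply: subspaceB => //; apply: subspaceZ.
Qed.

Lemma acc_add_span s W vs : subspace W -> invariant s W ->
  (forall v j, v \in vs -> j \in s -> W (T j v)) ->
  acc s W -> acc s (add_span W vs).
Proof.
move=> sW iW hvs aW; elim: vs hvs => //= v vs IH hvs.
have hvs' u j : u \in vs -> j \in s -> W (T j u).
  by move=> hu; apply: hvs; rewrite inE hu orbT.
apply: acc_add_line; last exact: IH.
  exact: subspace_add_span.
exact: invariant_add_span.
Qed.

(** The diagonal of the double chain stabilises at some index [N], which
    takes care of all rows from [N] on; the finitely many earlier rows
    stabilise one by one. *)
Lemma acc_double_chain s W (L : nat -> nat -> set A) : acc s W ->
  (forall n k, subspace (L n k)) -> (forall n k, invariant s (L n k)) ->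
  (forall n k, L n k `<=` W) ->
  (forall n k, L n k `<=` L n.+1 k) -> (forall n k, L n k `<=` L n k.+1) ->
  exists K, forall n k, (K <= k)%N -> L n k `<=` L n K.
Proof.
move=> aW sL iL LW mL1 mL2.
have le1 k := @chain_le (L^~ k) (mL1^~ k).
have le2 n := @chain_le (L n) (mL2 n).
have [N hN] : exists N, forall n, (N <= n)%N -> L n n `<=` L N N.
  apply: (aW (fun n => L n n)) => // n; exact: subset_trans (mL1 _ _) (mL2 _ _).
have [K hK] : exists K, forall n, (n < N)%N ->
    forall k, (K <= k)%N -> L n k `<=` L n K.
  elim: N {hN} => [|N [K hK]]; first by exists 0%N.
  have [K' hK'] := aW (L N) (sL N) (iL N) (LW N) (mL2 N).
  exists (maxn K K') => n; rewrite ltnS leq_eqVlt => /orP[/eqP->|/hK hn] k.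
    rewrite geq_max => /andP[_ /hK' h]; apply: subset_trans h _.
    by apply: le2; rewrite leq_maxr.
  rewrite geq_max => /andP[/hn h _]; apply: subset_trans h _.
  by apply: le2; rewrite leq_maxl.
exists (maxn N K) => n k; rewrite geq_max => /andP[lek leK].
have [lt_nN|le_Nn] := ltnP n N.
  by apply: subset_trans (hK n lt_nN k leK) _; apply: le2; rewrite leq_maxr.
apply: (@subset_trans _ (L (maxn n k) (maxn n k))).
  apply: subset_trans (le1 k n _ (leq_maxl n k)) _.
  by apply: le2; rewrite leq_maxr.
apply: subset_trans (hN _ _) _; first by rewrite leq_max le_Nn.
by apply: subset_trans (le1 N _ _ le_Nn) _; apply: le2; rewrite leq_maxl.
Qed.

(** * Hilbert's basis theorem for operators commuting up to scalars *)

Section PowerSums.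
Variables (t : {linear A -> A}) (W : set A).
Hypothesis sW : subspace W.

(** Plays the role of the polynomials in [t] of degree less than [n] with
    coefficients in [W]. *)
Fixpoint powsum n : set A :=
  if n is m.+1 then sumsp (iter m t @` W) (powsum m) else [set 0].

Definition polysp : set A := \bigcup_n powsum n.

Lemma subspace_powsum n : subspace (powsum n).
Proof.
elim: n => [|n IH]; first exact: subspace_zero.
by apply: subspace_sum => //; apply: subspace_iter_image.
Qed.

Lemma powsum_le m n : (m <= n)%N -> powsum m `<=` powsum n.
Proof.
by apply: chain_le => k; apply: sub_sumspr; apply: subspace_iter_image.
Qed.

Lemma subspace_polysp : subspace polysp.
Proof.
apply/subspaceP; split; first by exists 0%N.
move=> c x y [m _ hx] [n _ hy]; exists (maxn m n) => //.
have hx' := powsum_le (leq_maxl m n) hx.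
have hy' := powsum_le (leq_maxr m n) hy.
by apply: subspaceD => //; [|apply: subspaceZ => //]; apply: subspace_powsum.
Qed.

Lemma iter_polysp n w : W w -> polysp (iter n t w).
Proof.
move=> hw; exists n.+1 => //=; apply: sub_sumspl; first exact: subspace_powsum.
by exists w.
Qed.

Lemma polysp_sub V : subspace V ->
  (forall n w, W w -> V (iter n t w)) -> polysp `<=` V.
Proof.
move=> sV hV x [n _]; elim: n x => [|n IH] x /=.
  by move=> ->; apply: subspace_0.
by apply: sumsp_sub x => // _ [w hw <-]; apply: hV.
Qed.

Lemma powsum_step n : powsum n `<=` t @^-1` powsum n.+1.
Proof.
elim: n => [|n IH].
  by move=> x -> /=; rewrite linear0; apply: (subspace_0 (subspace_powsum 1)).
apply: sumsp_sub; first by apply: subspace_preim; apply: subspace_powsum.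
  move=> _ [w hw <-]; apply: sub_sumspl; first exact: (subspace_powsum n.+1).
  by exists w.
move=> x /IH; apply: powsum_le => //.
Qed.

Lemma stable_polysp : stable t polysp.
Proof. by move=> x [n _ /powsum_step hx]; exists n.+1. Qed.

End PowerSums.

(** The scalar [e] is nonzero in order to be able to move powers of [t] across
    [f] in both directions. *)
Definition skew_commute (f t : A -> A) M :=
  exists2 e : F, e != 0 & forall x, M x -> f (t x) = e *: t (f x).

Lemma skew_commute_iter (f t : {linear A -> A}) M n :
  skew_commute f t M -> stable t M -> skew_commute f (iter n t) M.
Proof.
move=> [e e0 he] tM; exists (e ^+ n) => [|x Mx]; first exact: expf_neq0.
elim: n => [|n IH] /=; first by rewrite expr0 scale1r.
have Mn : M (iter n t x) by elim: n {IH} => //= n; apply: tM.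
by rewrite he // IH linearZ /= scalerA exprS.
Qed.

Section HilbertStep.
Variables (s : seq J) (t : {linear A -> A}) (W M : set A).
Hypotheses (sW : subspace W) (iW : invariant s W) (WM : W `<=` M).
Hypotheses (tM : stable t M).
Hypothesis sct : forall j, j \in s -> skew_commute (T j) t M.

Lemma invariant_powsum n : invariant s (powsum t W n).
Proof.
move=> j js; elim: n => [|n IH].
  by move=> x -> /=; rewrite linear0.
have sP := subspace_powsum t sW.
apply: sumsp_sub; first by apply: subspace_preim; apply: sP.
  move=> _ [w hw <-] /=; have [e _ he] := skew_commute_iter n (sct js) tM.
  rewrite he; last exact: WM.
  apply: subspaceZ; first exact: (sP n.+1).
  apply: sub_sumspl => //; exists (T j w) => //; exact: iW.
by move=> x /IH; apply: powsum_le.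
Qed.

Lemma invariant_polysp : invariant s (polysp t W).
Proof. by move=> j js x [n _ /(invariant_powsum js)]; exists n. Qed.

(** Possible coefficients of [t ^ n] in the elements of [U], the degree [n]
    analogue of the ideal of leading coefficients. *)
Definition leading n (U : set A) : set A :=
  W `&` iter n t @^-1` sumsp U (powsum t W n).

Lemma subspace_leading n U : subspace U -> subspace (leading n U).
Proof.
move=> sU; apply: subspaceI => //; apply: subspace_iter_preim.
by apply: subspace_sum => //; apply: subspace_powsum.
Qed.

(** From [t ^ n w = u + y] follows [t ^ n (T j w) = e^-1 *: (T j u + T j y)],
    where the scalar [e] comes from moving [T j] across [t ^ n]. *)
Lemma invariant_leading n U :
  subspace U -> invariant s U -> invariant s (leading n U).
Proof.
move=> sU iU j js w [hw hn]; split; first exact: iW.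
have sS : subspace (sumsp U (powsum t W n)).
  by apply: subspace_sum => //; apply: subspace_powsum.
have [e e0 he] := skew_commute_iter n (sct js) tM.
rewrite /=; have -> : iter n t (T j w) = e^-1 *: T j (iter n t w).
  by rewrite he ?scalerA ?mulVf ?scale1r //; apply: WM.
apply: subspaceZ => //.
have : sumsp U (powsum t W n) `<=` T j @^-1` sumsp U (powsum t W n); last exact.
apply: sumsp_sub; first exact: subspace_preim.
- move=> u hu; apply: sub_sumspl; [exact: subspace_powsum | exact: iU].
- by move=> y hy; apply: sub_sumspr => //; apply: invariant_powsum.
Qed.

Lemma leading_step n U :
  subspace U -> stable t U -> leading n U `<=` leading n.+1 U.
Proof.
move=> sU tU w [hw hn]; split=> //=.
suff : sumsp U (powsum t W n) `<=` t @^-1` sumsp U (powsum t W n.+1) by exact.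
apply: sumsp_sub.
- by apply/subspace_preim/subspace_sum => //; apply: subspace_powsum.
- by move=> u /tU ut; apply: (sub_sumspl (subspace_powsum t sW n.+1)).
- by move=> y /(powsum_step sW) hy; apply: (sub_sumspr sU).
Qed.

Lemma leading_sub n U V : U `<=` V -> leading n U `<=` leading n V.
Proof. by move=> UV; apply: setIS => w; apply: sumspS. Qed.

(** Division by lower leading terms: an element of [V] of degree [n] agrees,
    up to lower degree, with an element of [U]. *)
Lemma sub_of_leading U V : subspace U -> subspace V -> U `<=` V ->
  V `<=` polysp t W -> (forall n, leading n V `<=` leading n U) -> V `<=` U.
Proof.
move=> sU sV UV VP hL x Vx; have [n _ hn] := VP x Vx.
elim: n x Vx hn => [|n IH] x Vx /=; first by move=> ->; apply: subspace_0.
move=> [_ [y [[w hw <-] hy ex]]].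
have [_ [u [z [hu hz ew]]]] : leading n U w.
  apply: hL; split=> //; exists x, (- y); split=> //.
    by rewrite -scaleN1r; apply: subspaceZ => //; apply: subspace_powsum.
  by rewrite ex addrK.
have -> : x = u + (z + y) by rewrite ex ew addrA.
apply: subspaceD => //; apply: IH.
  have -> : z + y = x - u by rewrite ex ew [RHS]addrC -(addrA u) addKr.
  by apply: subspaceB => //; apply: UV.
by apply: subspaceD => //; apply: subspace_powsum.
Qed.

Lemma acc_polysp (j0 : J) : T j0 = t -> acc s W -> acc (j0 :: s) (polysp t W).
Proof.
move=> ej aW U sU iU UP mU.
have tU n : stable t (U n) by rewrite -ej; apply: iU; rewrite mem_head.
have iU' n : invariant s (U n).
  by move=> j js; apply: iU; rewrite inE js orbT.
have [||||| K hK] := @acc_double_chain s W (fun n k => leading n (U k)) aW.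
- by move=> n k; apply: subspace_leading.
- by move=> n k; apply: invariant_leading.
- by move=> n k; apply: subIsetl.
- by move=> n k; apply: leading_step.
- by move=> n k; apply: leading_sub.
exists K => k leK; apply: sub_of_leading => // [|n]; first exact: chain_le leK.
exact: hK.
Qed.

End HilbertStep.

(** Span of the images of [W] under the monomials
    [T j1 ^ n1 \o ... \o T jr ^ nr] for [s = [:: j1; ...; jr]]. The order of the
    factors is fixed, which loses nothing when the operators commute up to
    scalars. *)
Definition monomial_span W s := foldr (fun j => polysp (T j)) W s.

Lemma subspace_monomial_span W s : subspace W -> subspace (monomial_span W s).
Proof. by move=> sW; elim: s => //= j r; apply: subspace_polysp. Qed.

Lemma sub_monomial_span W s : subspace W -> W `<=` monomial_span W s.
Proof.
move=> sW; elim: s => //= j r IH x /IH.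
exact: (iter_polysp (T j) (subspace_monomial_span r sW) 0).
Qed.

Section HilbertBasis.
Variables (W M : set A) (s : seq J).
Hypotheses (sW : subspace W) (WM : W `<=` M) (sM : subspace M).
Hypotheses (iM : invariant s M).
Hypothesis skewM :
  forall i j, i \in s -> j \in s -> skew_commute (T i) (T j) M.

(** Each operator is adjoined by [acc_polysp]; the ambient [M] is a space on
    which the operators are known to commute up to scalars. *)
Lemma skew_hilbert_basis : acc [::] W ->
  [/\ monomial_span W s `<=` M,
      invariant s (monomial_span W s) & acc s (monomial_span W s)].
Proof.
move=> aW; elim: s iM skewM => [|j r IH] iM' skM; first by split.
have sP := subspace_monomial_span r sW.
have [||PM iP aP] := IH.
- by move=> i ir; apply: iM'; rewrite inE ir orbT.
- by move=> i k ir kr; apply: skM; rewrite inE ?ir ?kr orbT.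
have jM : stable (T j) M by apply: iM'; rewrite mem_head.
have sk i : i \in r -> skew_commute (T i) (T j) M.
  by move=> ir; apply: skM; rewrite ?mem_head // inE ir orbT.
split=> /=.
- apply: polysp_sub => // n w /PM; elim: n => //= n IHn /IHn; exact: jM.
- move=> i; rewrite inE => /orP[/eqP->|ir]; first exact: stable_polysp.
  exact: (invariant_polysp sP iP PM jM sk).
- exact: (acc_polysp sP iP PM jM sk).
Qed.

End HilbertBasis.
End InvariantChains.

(** * Bicommutative superalgebras *)

Section Bicommutative.
Set Implicit Arguments.
Unset Strict Implicit.
Context (F : fieldType) (A : lmodType F) (mul : {bilinear A -> A -> A}).
Context (gr : bool -> set A).
Hypotheses (superA : superalgebra mul gr) (bicA : bicommutative mul gr).
Implicit Types (u v w x y z : A) (V W C : set A).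

Lemma subspace_gr i : subspace (gr i).
Proof. by case: superA. Qed.

Lemma gr_mul i j x y : gr i x -> gr j y -> gr (i (+) j) (mul x y).
Proof. by case: superA => _ _ _; apply. Qed.

Lemma homogeneous_ind V : subspace V -> (forall i x, gr i x -> V x) ->
  forall x, V x.
Proof.
case: superA => _ dec _ _ sV hV x; have [x0 [x1 [h0 h1 ->]]] := dec x.
by apply: subspaceD; [| apply: hV h0 | apply: hV h1].
Qed.

Lemma subspace_eq (f g : A -> A) : linear f -> linear g ->
  subspace [set z | f z = g z].
Proof.
move=> lf lg.
have z0 (h : A -> A) : linear h -> h 0 = 0.
  move=> lh; have := lh (-1) 0 0.
  by rewrite scaleN1r oppr0 addr0 scaleN1r addNr.
apply/subspaceP; split=> /= [|c x y]; first by rewrite !z0.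
by rewrite lf lg => -> ->.
Qed.

(** The sign does not depend on [z], so the identity extends by linearity to
    [z] that are not homogeneous; likewise in [right_comm]. *)
Lemma left_comm i j x y z : gr i x -> gr j y ->
  mul x (mul y z) = (-1) ^+ (i && j) *: mul y (mul x z).
Proof.
move=> hx hy; move: z; apply: homogeneous_ind.
  apply: subspace_eq => c z z'; rewrite !linearPr //.
  by rewrite scalerDr !scalerA mulrC.
by move=> k z hz; case: bicA => + _; apply; [exact: hx | exact: hy | exact: hz].
Qed.

Lemma right_comm i j x y z : gr i y -> gr j z ->
  mul (mul x y) z = (-1) ^+ (i && j) *: mul (mul x z) y.
Proof.
move=> hy hz; move: x; apply: homogeneous_ind.
  apply: subspace_eq => c x x'; rewrite !linearPl //.
  by rewrite scalerDr !scalerA mulrC.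
by move=> k x hx; case: bicA => _; apply; [exact: hx | exact: hy | exact: hz].
Qed.

Definition middle_nucleus : set A :=
  [set z | forall x y, mul x (mul z y) = mul (mul x z) y].

Lemma subspace_nucleus : subspace middle_nucleus.
Proof.
apply/subspaceP; split=> [x y|c z z' hz hz' x y].
  by rewrite linear0l !linear0r linear0l.
by rewrite linearPl !linearPr linearPl hz hz'.
Qed.

(** For homogeneous arguments, up to signs that cancel:
    [(x(uv))y = (xy)(uv) = u((xy)v) = u((xv)y) = (xv)(uy) = (x(uy))v
    = (u(xy))v = (uv)(xy) = x((uv)y)]. *)
Lemma product_in_nucleus u v : middle_nucleus (mul u v).
Proof.
move: u; apply: homogeneous_ind.
  apply/subspaceP; split=> [|c u u' hu hu'] /=.
    by rewrite linear0l; apply: (subspace_0 subspace_nucleus).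
  by rewrite linearPl; case/subspaceP: subspace_nucleus => _; apply.
move=> a u hu; move: v; apply: homogeneous_ind.
  apply/subspaceP; split=> [|c v v' hv hv'] /=.
    by rewrite linear0r; apply: (subspace_0 subspace_nucleus).
  by rewrite linearPr; case/subspaceP: subspace_nucleus => _; apply.
move=> b v hv x y; move: x; apply: homogeneous_ind.
  by apply: subspace_eq => c x x'; rewrite !linearPl.
move=> c x hx; move: y; apply: homogeneous_ind.
  by apply: subspace_eq => e y y'; rewrite !linearPr.
move=> d y hy; symmetry.
rewrite (right_comm x (gr_mul hu hv) hy).
rewrite (left_comm v (gr_mul hx hy) hu) (right_comm x hy hv) linearZr_LR.
rewrite (left_comm y hu (gr_mul hx hv)) (right_comm x hv (gr_mul hu hy)).
rewrite (left_comm y hx hu) linearZl_LR (right_comm u (gr_mul hx hy) hv).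
rewrite (left_comm y (gr_mul hu hv) hx) !scalerA -!signr_addb.
by case: a b c d {hu hv hx hy} => [] [] [] []; rewrite /= scale1r.
Qed.

(** ** Graded subspaces *)

Definition graded_core V : set A := [set x | exists x0 x1,
  [/\ gr false x0 /\ V x0, gr true x1 /\ V x1 & x = x0 + x1]].

Definition graded V := V `<=` graded_core V.

Lemma subspace_graded_core V : subspace V -> subspace (graded_core V).
Proof.
move=> sV.
have -> : graded_core V = sumsp (gr false `&` V) (gr true `&` V) by [].
by apply: subspace_sum; apply: subspaceI => //; apply: subspace_gr.
Qed.

Lemma graded_core_homogeneous V i x :
  subspace V -> gr i x -> V x -> graded_core V x.
Proof.
move=> sV; have V0 := subspace_0 sV.
have g0 j : gr j 0 by apply: subspace_0; apply: subspace_gr.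
case: i => hx Vx; first by exists 0, x; rewrite add0r.
by exists x, 0; rewrite addr0.
Qed.

Lemma graded_add_span vs : (forall v, v \in vs -> homogeneous gr v) ->
  graded (add_span [set 0] vs).
Proof.
have s0 := subspace_zero A; have sS := subspace_add_span vs s0.
have sG := subspace_graded_core sS.
move=> hvs; apply: add_span_sub => // [x /= ->|v hv].
  exact: subspace_0.
have [i hi] := hvs v hv; apply: graded_core_homogeneous hi _ => //.
exact: mem_add_span.
Qed.

Lemma graded_polysp (t : {linear A -> A}) W : subspace W ->
  (forall x, homogeneous gr x -> homogeneous gr (t x)) ->
  graded W -> graded (polysp t W).
Proof.
move=> sW ht gW; have sP := subspace_polysp t sW.
have sG := subspace_graded_core sP.
apply: polysp_sub => // n w /gW[x0 [x1 [[h0 W0] [h1 W1] ->]]].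
have hn x : homogeneous gr x -> homogeneous gr (iter n t x).
  by move=> hx; elim: n => //= n; apply: ht.
have key i x : gr i x -> W x -> graded_core (polysp t W) (iter n t x).
  move=> hx Wx; have [|j hj] := hn x; first by exists i.
  by apply: graded_core_homogeneous hj _ => //; apply: iter_polysp.
rewrite -[x0]scale1r linear_iter scale1r.
by apply: subspaceD => //; [apply: key h0 W0 | apply: key h1 W1].
Qed.

(** ** Multiplication operators *)

Definition mulop (p : bool * A) : {linear A -> A} :=
  if p.1 then mul p.2 : {linear A -> A} else applyr mul p.2 : {linear A -> A}.

Lemma mulop_homogeneous p x : homogeneous gr p.2 ->
  homogeneous gr x -> homogeneous gr (mulop p x).
Proof.
case: p => -[] a /= [i ha] [j hx]; first by exists (i (+) j); apply: gr_mul.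
by exists (j (+) i); apply: (gr_mul hx ha).
Qed.

Lemma mulop_nucleus p x : middle_nucleus (mulop p x).
Proof. by case: p => -[] a; apply: product_in_nucleus. Qed.

(** Two operators on the same side commute up to a sign; for operators on
    opposite sides, commuting is the definition of the middle nucleus. *)
Lemma mulop_skew_commute p q : homogeneous gr p.2 -> homogeneous gr q.2 ->
  skew_commute (mulop p) (mulop q) middle_nucleus.
Proof.
case: p q => -[] a [[] b] [i /= ha] [j /= hb].
- exists ((-1) ^+ (i && j)) => [|x _]; first by rewrite signr_eq0.
  exact: left_comm.
- by exists 1 => [|x hx]; rewrite ?oner_neq0 // scale1r; apply: hx.
- by exists 1 => [|x hx]; rewrite ?oner_neq0 // scale1r; symmetry; apply: hx.
- exists ((-1) ^+ (j && i)) => [|x _]; first by rewrite signr_eq0.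
  exact: (right_comm x hb ha).
Qed.

Definition idealizer W : set A :=
  [set a | forall w, W w -> W (mul a w) /\ W (mul w a)].

Lemma subspace_idealizer W : subspace W -> subspace (idealizer W).
Proof.
move=> sW; apply/subspaceP; split=> [w _|c a b ha hb w hw].
  by rewrite linear0l linear0r; split; apply: subspace_0.
rewrite linearPl linearPr; have [a1 a2] := ha w hw; have [b1 b2] := hb w hw.
by split; apply: subspaceD => //; apply: subspaceZ.
Qed.

(** On a homogeneous [x], multiplying by [uv] amounts, up to sign, to
    multiplying by [u] and [v] in turn: [(uv)x = +- (ux)v] and
    [x(uv) = +- u(xv)]. *)
Lemma idealizer_mul_homogeneous W i j u v : subspace W -> graded W ->
  gr i u -> gr j v -> idealizer W u -> idealizer W v ->
  idealizer W (mul u v).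
Proof.
move=> sW gW hu hv iu iv w /gW[w0 [w1 [[h0 W0] [h1 W1] ->]]].
have key k x : gr k x -> W x -> W (mul (mul u v) x) /\ W (mul x (mul u v)).
  move=> hx Wx; rewrite (right_comm u hv hx) (left_comm v hx hu).
  split; apply: subspaceZ => //.
    by case: (iv (mul u x)) => //; case: (iu x).
  by case: (iu (mul x v)) => //; case: (iv x).
rewrite linearDr linearDl; have [a1 a2] := key _ _ h0 W0.
by have [b1 b2] := key _ _ h1 W1; split; apply: subspaceD.
Qed.

Lemma subalgebra_graded_core C : subspace C ->
  (forall i j u v, gr i u -> gr j v -> C u -> C v -> C (mul u v)) ->
  subalgebra mul (graded_core C).
Proof.
move=> sC hC; have sG := subspace_graded_core sC.
split=> // _ _ [x0 [x1 [[g0 c0] [g1 c1] ->]]] [y0 [y1 [[h0 d0] [h1 d1] ->]]].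
have key i j u v : gr i u -> gr j v -> C u -> C v -> graded_core C (mul u v).
  move=> hu hv Cu Cv; apply: graded_core_homogeneous (gr_mul hu hv) _ => //.
  exact: hC hu hv Cu Cv.
rewrite linearDl !linearDr; apply: subspaceD => //; apply: subspaceD => //.
- exact: key g0 h0 _ _.
- exact: key g0 h1 _ _.
- exact: key g1 h0 _ _.
- exact: key g1 h1 _ _.
Qed.

(** * Finitely generated algebras *)

Section Generators.
Variable s : seq A.
Hypothesis hs : forall x, x \in s -> homogeneous gr x.
Hypothesis gen : smallest (subalgebra mul) [set` s] = setT.

Let ops : seq (bool * A) := [seq (b, g) | b <- [:: true; false], g <- s].
Let products := [seq mul g h | g <- s, h <- s].
(** This subspace is [A^2]; its description by monomials is the one to which
    [skew_hilbert_basis] applies. *)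
Let square := monomial_span mulop (add_span [set 0] products) ops.

Lemma generator_ops b g : g \in s -> (b, g) \in ops.
Proof. by move=> gs; apply: allpairs_f => //; case: b. Qed.

Lemma ops_homogeneous p : p \in ops -> homogeneous gr p.2.
Proof. by move=> /allpairsP[[b g] [_ /= gs ->]] /=; apply: hs. Qed.

Lemma subspace_square : subspace square.
Proof. by apply/subspace_monomial_span/subspace_add_span/subspace_zero. Qed.

Lemma square_noetherian : invariant mulop ops square /\ acc mulop ops square.
Proof.
have s0 := subspace_zero A.
have [||||||_ iS aS] :=
  @skew_hilbert_basis _ _ _ mulop (add_span [set 0] products)
    middle_nucleus ops.
- exact: subspace_add_span.
- apply: add_span_sub; first exact: subspace_nucleus.
    by move=> x ->; apply: (subspace_0 subspace_nucleus).
  by move=> _ /allpairsP[[g h] [_ _ ->]]; apply: product_in_nucleus.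
- exact: subspace_nucleus.
- by move=> p _ x _; apply: mulop_nucleus.
- by move=> p q /ops_homogeneous hp /ops_homogeneous; apply: mulop_skew_commute.
- by apply: acc_add_span => //; apply: acc_zero.
by split.
Qed.

Lemma graded_square : graded square.
Proof.
have hops := ops_homogeneous; rewrite /square; elim: ops hops => [|p r IH] hops.
  apply: graded_add_span => _ /allpairsP[[g h] [/hs hg /hs hh ->]].
  by case: hg hh => [i gi] [j hj]; exists (i (+) j); apply: gr_mul.
apply: graded_polysp.
- by apply/subspace_monomial_span/subspace_add_span/subspace_zero.
- by move=> x; apply: mulop_homogeneous; apply: hops; rewrite mem_head.
- by apply: IH => q hq; apply: hops; rewrite inE hq orbT.
Qed.

(** The elements whose even and odd parts both idealize [square] form a
    subalgebra containing the generators. *)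
Lemma square_ideal a : idealizer square a.
Proof.
have sS := subspace_square; have sI := subspace_idealizer sS.
have : smallest (subalgebra mul) [set` s] a by rewrite gen.
suff h : smallest (subalgebra mul) [set` s] `<=` graded_core (idealizer square).
  by move=> /h[a0 [a1 [[_ h0] [_ h1] ->]]]; exact: (subspaceD sI h0 h1).
apply: smallest_sub.
  apply: subalgebra_graded_core => // i j u v hu hv.
  by apply: idealizer_mul_homogeneous hu hv => //; apply: graded_square.
move=> g /= gs; have [i hg] := hs gs; apply: graded_core_homogeneous hg _ => //.
have [iS _] := square_noetherian => w hw.
by split; [apply: (iS (true, g)) | apply: (iS (false, g))] => //;
  apply: generator_ops.
Qed.

Lemma generators_mul g h : g \in s -> h \in s -> square (mul g h).
Proof.
have s0 := subspace_zero A.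
move=> gs hs'; apply: sub_monomial_span; first exact: subspace_add_span.
by apply: mem_add_span => //; apply: allpairs_f.
Qed.

(** The span of the generators and [square] is a subalgebra because all
    products of two of its elements fall into [square]. *)
Lemma generators_span a : add_span square s a.
Proof.
have sS := subspace_square; have sB := subspace_add_span s sS.
have : smallest (subalgebra mul) [set` s] a by rewrite gen.
move: a; apply: smallest_sub => [|g gs]; last exact: mem_add_span.
split=> // x y hx hy; apply: sub_add_span; move: x hx y hy.
apply: add_span_sub.
- apply/subspaceP; split=> [y _|c x x' hx hx' y hy].
    by rewrite linear0l; apply: subspace_0.
  rewrite linearPl; apply: subspaceD => //; last exact: hx'.
  by apply: subspaceZ => //; apply: hx.
- by move=> x hx y _; have [_] := square_ideal y hx.
- move=> g gs y; move: y; apply: (@add_span_sub _ _ _ _ (mul g @^-1` square)).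
  + exact: (subspace_preim (mulop (true, g)) sS).
  + by move=> w hw; have [] := square_ideal g hw.
  + by move=> h hh; apply: generators_mul.
Qed.

Lemma weakly_noetherian_of_generators : weakly_noetherian mul.
Proof.
move=> I idI mI.
have sS := subspace_square; have [iS aS] := square_noetherian.
have [|||||N hN] := acc_add_span (vs := s) sS iS _ aS (U := I).
- move=> g p gs /allpairsP[[[] h] [_ /= hh ->]]; exact: generators_mul.
- by move=> n; case: (idI n).
- by move=> n [[] a] _ x Ix; have [_ /(_ a x Ix)[]] := idI n.
- by move=> n x _; apply: generators_span.
- exact: mI.
exists N => n le_Nn; apply/seteqP; split; first exact: hN.
exact: chain_le.
Qed.

End Generators.
End Bicommutative.

Theorem theorem4p3 (F : fieldType) (A : lmodType F)
    (mul : {bilinear A -> A -> A}) (gr : bool -> set A) :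
  2%N \notin [pchar F] ->
  superalgebra mul gr ->
  bicommutative mul gr ->
  finitely_generated mul gr ->
  weakly_noetherian mul.
Proof.
move=> _ superA bicA [s [hs gen]].
exact: (weakly_noetherian_of_generators superA bicA hs gen).
Qed.
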